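(* Let $n>2$ and $t>2$ be two positive integers. Then \[\varphi(P_n\boxdot P_t)=\begin{cases} 4, & \text{if } n=3 \text{ and } t\in\{3,4\},\\ 5, & \text{if either } (n=3 \text{ and } t\geq 5) \text{ or } n\in\{4,5\},\\ n-1, & \text{if } 6\leq n\leq 2t+3,\\ 2t+3, & \text{otherwise (that is, if } n>2t+3 \text{ and none of the previous cases applies)}. \end{cases}\]
   Context: All graphs are finite and simple. $P_n$ denotes the path with $n$ vertices. The subdivision graph $S(G)$ of a graph $G$ is obtained by inserting one new vertex into every edge of $G$. For graphs $G$ and $H$, with $V(G)=\{u_0,\ldots,u_{m-1}\}$, the subdivision-vertex neighbourhood corona (SVN corona) $G\boxdot H$ is the graph obtained from $S(G)$ by adding $m$ vertex-disjoint copies of $H$ (one for each $u_i$) and joining, for each $i$, every vertex of $N_{S(G)}(u_i)$ (the neighbourhood of $u_i$ in $S(G)$) to every vertex of the copy of $H$ associated with $u_i$. A $b$-chromatic coloring of a graph with $k$ colors is a proper coloring with colors $0,\ldots,k-1$ such that, for each color $i$, there is a vertex (a $b$-vertex) of color $i$ having, for each color $j\neq i$, a neighbour of color $j$. The $b$-chromatic number $\varphi(G)$ is the maximum $k$ for which $G$ has a $b$-chromatic coloring with $k$ colors. *)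

(* Defs.v *)
From mathcomp Require Import all_boot.

Set Implicit Arguments.
Unset Strict Implicit.
Unset Printing Implicit Defensive.

Record sgraph := SGraph {
  svertex :> finType;
  sadj : rel svertex;
  sadj_sym : symmetric sadj;
  sadj_irrefl : irreflexive sadj
}.
Arguments sadj {s} x y.

Section PathGraph.
Variable n : nat.

Definition path_adj : rel 'I_n :=
  fun i j => (i.+1 == j :> nat) || (j.+1 == i :> nat).

Lemma path_adj_sym : symmetric path_adj.
Proof. by move=> i j; rewrite /path_adj orbC. Qed.

Lemma path_adj_irrefl : irreflexive path_adj.
Proof. by move=> i; rewrite /path_adj orbb gtn_eqF. Qed.

Definition path_graph : sgraph := SGraph path_adj_sym path_adj_irrefl.
End PathGraph.

Section Subdivision.
Variable G : sgraph.

Definition is_edge (e : {set G}) : bool :=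
  [exists x, exists y, sadj x y && (e == [set x; y])].

Definition edge : finType := {e : {set G} | is_edge e}.

(* inl u is the original vertex u; inr e is the vertex inserted into e. *)
Definition subdiv_adj : rel (G + edge)%type := fun a b =>
  match a, b with
  | inl u, inr e | inr e, inl u => u \in val e
  | _, _ => false
  end.

Lemma subdiv_adj_sym : symmetric subdiv_adj.
Proof. by case=> [u|e] [v|f]. Qed.

Lemma subdiv_adj_irrefl : irreflexive subdiv_adj.
Proof. by case. Qed.

Definition subdivision : sgraph := SGraph subdiv_adj_sym subdiv_adj_irrefl.
End Subdivision.

Section Corona.
Variables G H : sgraph.

(* inr (u, x) is the vertex x of the copy of H associated with u. *)
Definition svn_adj : rel (subdivision G + G * H)%type := fun a b =>
  match a, b with
  | inl v, inl w => sadj v w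
  | inr (u, x), inr (u', y) => (u == u') && sadj x y
  | inl v, inr (u, _) | inr (u, _), inl v =>
      @sadj (subdivision G) (inl u) v
  end.

Lemma svn_adj_sym : symmetric svn_adj.
Proof.
case=> [v|[u x]] [w|[u' y]] //=; first exact: subdiv_adj_sym.
by rewrite eq_sym (sadj_sym x).
Qed.

Lemma svn_adj_irrefl : irreflexive svn_adj.
Proof.
case=> [v|[u x]] /=; first exact: subdiv_adj_irrefl.
by rewrite eqxx sadj_irrefl.
Qed.

Definition svn_corona : sgraph := SGraph svn_adj_sym svn_adj_irrefl.
End Corona.

Section BChromatic.
Variable G : sgraph.

Definition proper_coloring k (f : {ffun G -> 'I_k}) : bool :=
  [forall x, forall y, sadj x y ==> (f x != f y)].

Definition b_vertex k (f : {ffun G -> 'I_k}) (x : G) : bool :=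
  [forall j, (j != f x) ==> [exists y, sadj x y && (f y == j)]].

Definition b_coloring k (f : {ffun G -> 'I_k}) : bool :=
  proper_coloring f && [forall i, exists x, (f x == i) && b_vertex f x].

Definition b_colorable k : bool :=
  [exists f : {ffun G -> 'I_k}, b_coloring f].

(* Every color is used by a b-coloring, so bounding k by the number of
   vertices loses nothing: see b_colorable_leq_b_chromatic. *)
Definition b_chromatic : nat := \max_(k < #|G|.+1 | b_colorable k) k.

Lemma b_colorable_leq_card k : b_colorable k -> k <= #|G|.
Proof.
case/existsP=> f /andP[_ /forallP fP].
rewrite -[k in k <= _]card_ord.
have sub : 'I_k \subset codom f.
  apply/subsetP=> i _; have /existsP[x /andP[/eqP <- _]] := fP i.
  exact: codom_f.
exact: leq_trans (subset_leq_card sub) (leq_image_card _ _).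
Qed.

Lemma b_colorable_leq_b_chromatic k : b_colorable k -> k <= b_chromatic.
Proof.
move=> kP; have lt_k : k < #|G|.+1 by rewrite ltnS b_colorable_leq_card.
by rewrite /b_chromatic (bigD1 (Ordinal lt_k)) //= leq_maxl.
Qed.

Lemma b_colorable_b_chromatic : 0 < b_chromatic -> b_colorable b_chromatic.
Proof.
rewrite /b_chromatic; elim/big_ind: _ => // a b IHa IHb.
by rewrite /maxn; case: ifP.
Qed.
End BChromatic.

(* Main.v *)
(** Write [e_i] for the vertex inserted between [u_i] and [u_{i+1}].  The [n - 1]
    vertices [e_i] have degree [2 t + 2] and all others have degree at most 4, so
    with at least 6 colours every b-vertex is some [e_i]; hence there are at most
    [min (n - 1) (2 t + 3)] colours.  For [n = 3] and [t <= 4] only four vertices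
    have degree at least 4.  Conversely, with [k] colours give [e_i] the colour
    [min i (k - 1)], and let [u_i] and its copy of [P_t] share the colours
    [c < i] of the parity of [i] and [c > i] of the other parity: these avoid [i]
    and [i - 1], and the sets for [i] and [i + 1] cover every colour but [i].
    Each set is laid out periodically along the copy, [u_i] taking its last
    element.  The cases [n <= 5] use explicit colourings of the same shape. *)

Require Import Defs.
From mathcomp Require Import all_boot.
From mathcomp Require Import zify.

Set Implicit Arguments.
Unset Strict Implicit.
Unset Printing Implicit Defensive.

(** * Counting bounds from lists of neighbours and of b-vertices *)

(** The colour of [x] and the colours on [s] exhaust all [k] colours. Any list covering the
    neighbours will do, so no degree function is needed. *)
Lemma b_vertex_leq (G : sgraph) k (f : {ffun G -> 'I_k}) (x : G) (s : seq G) :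
  b_vertex f x -> (forall y, sadj x y -> y \in s) -> k <= (size s).+1.
Proof.
move=> /forallP bx sub; rewrite -[k in k <= _]card_ord -(size_map f s).
have /subset_leq_card : 'I_k \subset f x :: map f s.
  apply/subsetP => j _; rewrite inE; case: eqVneq => //= jNx.
  have /implyP/(_ jNx)/existsP[y /andP[xy /eqP <-]] := bx j.
  by rewrite map_f ?sub.
by move/leq_trans; apply; apply: card_size.
Qed.

Lemma b_coloring_leq (G : sgraph) k (f : {ffun G -> 'I_k}) (s : seq G) :
  b_coloring f -> (forall x, b_vertex f x -> x \in s) -> k <= size s.
Proof.
move=> /andP[_ /forallP bf] sub; rewrite -[k in k <= _]card_ord -(size_map f s).
have /subset_leq_card : 'I_k \subset map f s.
  apply/subsetP => j _; have /existsP[x /andP[/eqP <- bx]] := bf j.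
  by rewrite map_f ?sub.
by move/leq_trans; apply; apply: card_size.
Qed.

Lemma b_chromatic_leq (G : sgraph) b :
  (forall k, b_colorable G k -> k <= b) -> b_chromatic G <= b.
Proof. by move=> le_b; apply/bigmax_leqP => k; apply: le_b. Qed.

(** The periodic word with period [s]. For a duplicate-free [s] of size at least 2, consecutive
    letters differ, so it properly colours a path of any length. *)
Definition cyc (s : seq nat) (x : nat) : nat := nth 0 s (x %% size s).

Lemma cyc_mem s x : 1 < size s -> cyc s x \in s.
Proof. by move=> s2; rewrite mem_nth // ltn_pmod // ltnW. Qed.

Lemma cyc_neq s x : uniq s -> 1 < size s -> cyc s x != cyc s x.+1.
Proof.
move=> us s2; have s0 := ltnW s2.
rewrite nth_uniq ?ltn_pmod // -addn1.
rewrite -{1}[x]addn0 eqn_modDl mod0n modn_small //.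
Qed.

Lemma cyc_index s j x : j \in s -> index j s = x -> cyc s x = j.
Proof. by move=> js <-; rewrite /cyc modn_small ?index_mem // nth_index. Qed.

(** * The corona of two paths in natural-number coordinates *)

Section PathCorona.

(* [P_n] and [P_t] with [n = m + 2] and [t = p + 1]. *)
Variables m p : nat.
Let G := path_graph m.+2.
Let H := path_graph p.+1.
Let K := svn_corona G H.

(* The endpoints of the edge joining [i] and [i + 1] sum to [2 i + 1]. *)
Definition edge_index (e : edge G) : nat := (\sum_(x in val e) (x : 'I_m.+2))./2.

Lemma edge_indexP (e : edge G) :
  edge_index e <= m /\
  forall u : G, (u \in val e) = (u == edge_index e :> nat) || (u == (edge_index e).+1 :> nat).
Proof.
rewrite /edge_index; case: e => e /= /existsP[x /existsP[y /andP[xy /eqP ->]]].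
have xNy : x != y by apply: contraTneq xy => ->; rewrite sadj_irrefl.
rewrite big_setU1 ?inE //= big_set1.
move: xy; rewrite /= /path_adj => xy.
have := ltn_ord x; have := ltn_ord y => ? ?.
split; first by lia.
move=> u; rewrite !inE -!val_eqE /=; lia.
Qed.

Lemma edge_index_inj : injective edge_index.
Proof.
move=> e e' ee'; apply/val_inj/setP => u.
by rewrite (edge_indexP e).2 (edge_indexP e').2 ee'.
Qed.

Lemma path_edge_subproof (i : 'I_m.+1) :
  @is_edge G [set inord i; inord i.+1].
Proof.
rewrite /is_edge; apply/existsP; exists (inord i); apply/existsP; exists (inord i.+1).
have := ltn_ord i => im.
by rewrite eqxx andbT /= /path_adj !inordK ?eqxx //; lia.
Qed.

Definition path_edge (i : nat) : edge G :=
  exist (@is_edge G) _ (path_edge_subproof (inord i)).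

Lemma path_edgeK i : i <= m -> edge_index (path_edge i) = i.
Proof.
move=> im; have [_ eP] := edge_indexP (path_edge i).
have := eP (inord i); have := eP (inord i.+1).
rewrite /= !inE !(inordK (_ : i < m.+1)) // !eqxx orbT.
rewrite !inordK //; lia.
Qed.

Lemma edge_indexK e : path_edge (edge_index e) = e.
Proof. by apply: edge_index_inj; rewrite path_edgeK // (edge_indexP e).1. Qed.

Definition ev (i : nat) : K := inl (inr (path_edge i)).
Definition uv (i : nat) : K := inl (inl (inord i)).
Definition cv (i x : nat) : K := inr (inord i, inord x).

(** A view for case analysis that replaces ordinals and edge sets by bounded naturals, within reach
    of [lia]. *)
Variant corona_vertex_spec : K -> Type :=
| IsEv i of i <= m : corona_vertex_spec (ev i)
| IsUv i of i <= m.+1 : corona_vertex_spec (uv i)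
| IsCv i x of i <= m.+1 & x <= p : corona_vertex_spec (cv i x).

Lemma corona_vertexP v : corona_vertex_spec v.
Proof.
case: v => [[u|e]|[u x]].
- by rewrite -[u]inord_val; apply: IsUv; rewrite -ltnS.
- by rewrite -[e]edge_indexK; apply: IsEv; exact: (edge_indexP e).1.
- by rewrite -[u]inord_val -[x]inord_val; apply: IsCv; rewrite -ltnS.
Qed.

Lemma mem_path_edge i j : i <= m -> j <= m.+1 ->
  ((inord j : G) \in val (path_edge i)) = (j == i) || (j == i.+1).
Proof. by move=> im jm; rewrite (edge_indexP _).2 path_edgeK // inordK. Qed.

Lemma adj_ev_ev i j : @sadj K (ev i) (ev j) = false. Proof. by []. Qed.
Lemma adj_uv_uv i j : @sadj K (uv i) (uv j) = false. Proof. by []. Qed.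
Lemma adj_uv_cv i j x : @sadj K (uv i) (cv j x) = false. Proof. by []. Qed.

Lemma adj_ev_uv i j : i <= m -> j <= m.+1 ->
  @sadj K (ev i) (uv j) = (j == i) || (j == i.+1).
Proof. exact: mem_path_edge. Qed.

Lemma adj_ev_cv i j x : i <= m -> j <= m.+1 ->
  @sadj K (ev i) (cv j x) = (j == i) || (j == i.+1).
Proof. exact: mem_path_edge. Qed.

Lemma adj_cv_cv i x j y : i <= m.+1 -> j <= m.+1 -> x <= p -> y <= p ->
  @sadj K (cv i x) (cv j y) = (i == j) && ((x.+1 == y) || (y.+1 == x)).
Proof.
move=> im jm xp yp; rewrite /= /path_adj !inordK //.
by rewrite -val_eqE /= !inordK.
Qed.

(** * Neighbourhoods and degrees *)

Definition adj_pathE := (adj_ev_ev, adj_uv_uv, adj_uv_cv, adj_ev_uv, adj_ev_cv, adj_cv_cv).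

Lemma ev_nbrs i : i <= m -> forall y, @sadj K (ev i) y ->
  y \in [:: uv i; uv i.+1] ++ [seq cv j x | j <- [:: i; i.+1], x <- iota 0 p.+1].
Proof.
move=> im y; case: (corona_vertexP y) => [j jm|j jm|j x jm xp]; rewrite !adj_pathE // => ij.
  by case/orP: ij => /eqP ->; rewrite !inE eqxx ?orbT.
rewrite mem_cat allpairs_f ?orbT //; first by rewrite !inE.
by rewrite mem_iota add0n ltnS.
Qed.

Lemma uv_nbrs i : i <= m.+1 -> forall y, @sadj K (uv i) y ->
  y \in [:: ev i.-1; ev i].
Proof.
move=> im y; case: (corona_vertexP y) => [j jm|j jm|j x jm xp] //.
by rewrite sadj_sym adj_ev_uv // => /orP[]/eqP ->; rewrite !inE eqxx ?orbT.
Qed.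

(** The guards drop the neighbours missing at the ends of either path, so that the size is the exact
    degree. *)
Definition cv_nbr_seq i x : seq K :=
  (if 0 < i then [:: ev i.-1] else [::]) ++ (if i <= m then [:: ev i] else [::]) ++
  (if 0 < x then [:: cv i x.-1] else [::]) ++ (if x < p then [:: cv i x.+1] else [::]).

Lemma cv_nbrs i x : i <= m.+1 -> x <= p -> forall y, @sadj K (cv i x) y ->
  y \in cv_nbr_seq i x.
Proof.
move=> im xp y; rewrite !mem_cat.
case: (corona_vertexP y) => [j jm|j jm|j z jm zp] //.
  rewrite sadj_sym adj_ev_cv // => /orP[]/eqP e; subst i.
    by rewrite jm !inE eqxx ?orbT.
  by rewrite /= !inE eqxx.
rewrite adj_cv_cv // => /andP[/eqP <- /orP[]/eqP e]; subst.
  by rewrite zp !inE eqxx ?orbT.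
by rewrite /= !inE eqxx ?orbT.
Qed.

Lemma size_cv_nbr_seq i x :
  size (cv_nbr_seq i x) = (0 < i) + (i <= m) + (0 < x) + (x < p).
Proof. by rewrite !size_cat !addnA; do 4!case: ifP => _. Qed.

(** * Upper bounds for the corona *)

Lemma corona_colors_leq k : 5 < k -> b_colorable K k -> k <= m.+1 /\ k <= 2 * p + 5.
Proof.
move=> k6 /existsP[f bf].
have b_ev v : b_vertex f v -> exists2 i, i <= m & v = ev i.
  case: (corona_vertexP v) => [i im _|i im bv|i x im xp bv]; first by exists i.
    by have /= := b_vertex_leq bv (uv_nbrs im); lia.
  by have := b_vertex_leq bv (cv_nbrs im xp); rewrite size_cv_nbr_seq; lia.
split.
  rewrite -(size_iota 0 m.+1) -(size_map ev); apply: (b_coloring_leq bf) => v.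
  by case/b_ev=> i im ->; rewrite map_f // mem_iota add0n ltnS.
(* Any b-vertex gives the second bound; the one of colour 0 is taken. Its neighbour list has size
   [2 + 2 * p.+1]. *)
have /andP[_ /forallP/(_ (Ordinal (ltn_trans (ltn0Sn _) k6)))] := bf.
case/existsP=> v /andP[_ bv]; have [i im vE] := b_ev v bv.
rewrite vE in bv; have := b_vertex_leq bv (ev_nbrs im).
by rewrite size_cat size_allpairs size_iota /=; lia.
Qed.

Lemma corona_P3_colors_leq k : m = 1 -> 1 < p <= 3 -> b_colorable K k -> k <= 4.
Proof.
move=> m1 p23 /existsP[f bf]; case: leqP => // k5.
(* With five colours a b-vertex has degree at least 4, hence is an inserted vertex or an inner
   vertex of the middle copy. *)
suff : k <= size [:: ev 0; ev 1; cv 1 1; cv 1 2] by rewrite leqNgt k5.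
apply: (b_coloring_leq bf) => v.
case: (corona_vertexP v) => [i im _|i im bv|i x im xp bv].
- have /orP[/eqP-> | /eqP->] : (i == 0) || (i == 1); first by lia.
    by rewrite inE eqxx.
  by rewrite !inE eqxx orbT.
- by have /= := b_vertex_leq bv (uv_nbrs im); lia.
have := b_vertex_leq bv (cv_nbrs im xp); rewrite size_cv_nbr_seq => kd.
have -> : i = 1 by lia.
have /orP[/eqP-> | /eqP->] : (x == 1) || (x == 2); first by lia.
  by rewrite !inE eqxx ?orbT.
by rewrite !inE eqxx ?orbT.
Qed.

(** * From numeric colour functions to b-colourings *)

Section Coloring.

Variables (k : nat) (E U : nat -> nat) (C : nat -> nat -> nat).

(** Boolean tests, so that concrete colourings are checked by computation. In [cv_sees] the
    adjacency guard rejects the spurious [x.-1] at [x = 0]. *)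
Definition ev_sees i j : bool :=
  has (fun d => (U d == j) || has (fun x => C d x == j) (iota 0 p.+1)) [:: i; i.+1].

Definition cv_sees i x j : bool :=
  has (fun d => [&& d <= m, i <= d.+1 & E d == j]) [:: i; i.-1] ||
  has (fun y => [&& y <= p, (x.+1 == y) || (y.+1 == x) & C i y == j]) [:: x.-1; x.+1].

Hypothesis ltE : forall i, i <= m -> E i <= k.
Hypothesis ltU : forall i, i <= m.+1 -> U i <= k.
Hypothesis ltC : forall i x, i <= m.+1 -> x <= p -> C i x <= k.
Hypothesis EU : forall i d, i <= m -> d \in [:: i; i.+1] -> E i != U d.
Hypothesis EC : forall i d x, i <= m -> d \in [:: i; i.+1] -> x <= p -> E i != C d x.
Hypothesis CC : forall i x, i <= m.+1 -> x < p -> C i x != C i x.+1.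
Hypothesis bEC : forall c, c <= k ->
  (exists i, [/\ i <= m, E i = c & forall j, j <= k -> j != c -> ev_sees i j]) \/
  (exists i x, [/\ i <= m.+1, x <= p, C i x = c &
     forall j, j <= k -> j != c -> cv_sees i x j]).

Lemma corona_b_colorable : b_colorable K k.+1.
Proof.
pose col (v : K) : nat := match v with
  | inl (inl u) => U (u : 'I_m.+2)
  | inl (inr e) => E (edge_index e)
  | inr (u, x) => C (u : 'I_m.+2) (x : 'I_p.+1) end.
have colE i : i <= m -> col (ev i) = E i by move=> im; rewrite /= path_edgeK.
have colU i : i <= m.+1 -> col (uv i) = U i by move=> im; rewrite /= inordK.
have colC i x : i <= m.+1 -> x <= p -> col (cv i x) = C i x.
  by move=> im xp; rewrite /= !inordK.
have lt_col v : col v <= k.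
  case: (corona_vertexP v) => [i im|i im|i x im xp].
  - by rewrite colE // ltE.
  - by rewrite colU // ltU.
  - by rewrite colC // ltC.
pose f := [ffun v : K => inord (col v) : 'I_k.+1].
have fE v w : (f v == f w) = (col v == col w).
  by rewrite !ffunE -val_eqE /= !inordK ?ltnS.
have fEj v (j : 'I_k.+1) : (f v == j) = (col v == j).
  by rewrite ffunE -val_eqE /= inordK ?ltnS.
apply/existsP; exists f; apply/andP; split.
  (* Every edge of the corona outside the copies of the path has an inserted vertex as an
     endpoint. *)
  have ne_col_ev i y : i <= m -> @sadj K (ev i) y -> col (ev i) != col y.
    move=> im; case: (corona_vertexP y) => [j jm|j jm|j z jm zp] //.
      by rewrite adj_ev_uv // colE // colU // => ij; apply: EU; rewrite // !inE.
    by rewrite adj_ev_cv // colE // colC // => ij; apply: EC; rewrite // !inE.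
  apply/forallP => v; apply/forallP => w; apply/implyP; rewrite fE.
  case: (corona_vertexP v) => [i im|i im|i x im xp]; first exact: ne_col_ev.
    case: (corona_vertexP w) => [j jm|j jm|j z jm zp] //.
    by rewrite sadj_sym eq_sym; apply: ne_col_ev.
  case: (corona_vertexP w) => [j jm|j jm|j z jm zp] //.
    by rewrite sadj_sym eq_sym; apply: ne_col_ev.
  rewrite adj_cv_cv // !colC // => /andP[/eqP <- /orP[]/eqP e]; subst.
    exact: CC.
  by rewrite eq_sym; apply: CC.
apply/forallP => c; have ck : c <= k by rewrite -ltnS.
have [[i [im Ec sees]]|[i [x [im xp Cc sees]]]] := bEC ck; apply/existsP.
  have fc : f (ev i) = c by apply/eqP; rewrite fEj colE // Ec.
  exists (ev i); rewrite fc eqxx /=; apply/forallP => j; apply/implyP; rewrite fc => jc.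
  have /hasP[d di /orP[Uj|/hasP[x]]] : ev_sees i j by apply: sees; rewrite // -ltnS.
    have dm : d <= m.+1 by move: di; rewrite !inE; lia.
    rewrite !inE in di.
    by apply/existsP; exists (uv d); rewrite adj_ev_uv // di fEj colU // (eqP Uj).
  have dm : d <= m.+1 by move: di; rewrite !inE; lia.
  rewrite !inE in di; rewrite mem_iota add0n ltnS => xp Cj.
  by apply/existsP; exists (cv d x); rewrite adj_ev_cv // di fEj colC // (eqP Cj).
have fc : f (cv i x) = c by apply/eqP; rewrite fEj colC // Cc.
exists (cv i x); rewrite fc eqxx /=; apply/forallP => j; apply/implyP; rewrite fc => jc.
have /orP[] : cv_sees i x j by apply: sees; rewrite // -ltnS.
  case/hasP=> d; rewrite !inE => di /and3P[dm id Ej]; apply/existsP; exists (ev d).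
  by rewrite sadj_sym adj_ev_cv // fEj colE // Ej andbT; lia.
case/hasP=> y _ /and3P[yp xy Cj]; apply/existsP; exists (cv i y).
by rewrite adj_cv_cv // eqxx xy fEj colC.
Qed.

End Coloring.

Lemma corona_b_colorable_cyc (k : nat) (E U : nat -> nat) (L : nat -> seq nat) :
  (forall i, i <= m -> E i <= k) ->
  (forall i, i <= m.+1 -> [&& U i <= k, uniq (L i), 1 < size (L i) & all (leq^~ k) (L i)]) ->
  (forall i, i <= m -> (E i \notin U i :: L i) && (E i \notin U i.+1 :: L i.+1)) ->
  (forall c, c <= k ->
    (exists i, [/\ i <= m, E i = c & forall j, j <= k -> j != c ->
       ev_sees U (fun d => cyc (L d)) i j]) \/
    (exists i x, [/\ i <= m.+1, x <= p, cyc (L i) x = c & forall j, j <= k -> j != c ->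
       cv_sees E (fun d => cyc (L d)) i x j])) ->
  b_colorable K k.+1.
Proof.
move=> ltE UL EUL bEC; apply: (@corona_b_colorable k E U (fun d => cyc (L d))) => //.
- by move=> i /UL/and4P[].
- by move=> i x /UL/and4P[_ _ s2 /allP] Lk _; apply/Lk/cyc_mem.
- by move=> i d /EUL; rewrite !inE !negb_or -!andbA => /and4P[? _ ? _] /orP[]/eqP ->.
- move=> i d x im; rewrite !inE => di _; apply: contraTneq (EUL i im) => Ei.
  have /UL/and4P[_ _ s2 _] : d <= m.+1 by lia.
  have := cyc_mem x s2; rewrite -Ei => EL; rewrite !inE !negb_or -!andbA.
  by case/orP: di => /eqP e; subst d; rewrite EL ?andbF.
- by move=> i x /UL/and4P[_ us s2 _] _; apply: cyc_neq.
Qed.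

End PathCorona.

(** * Explicit colourings for at most five vertices in the first path *)

(** Lets the explicit colourings be checked on the first three vertices of each copy, where [has]
    evaluates although [p] is a variable. *)
Lemma ev_sees_leq p q U C i j : q <= p -> ev_sees q U C i j -> ev_sees p U C i j.
Proof.
move=> qp; apply: sub_has => d /orP[->//|/hasP[x]]; rewrite mem_iota => xq Cj.
by apply/orP; right; apply/hasP; exists x; rewrite // mem_iota; lia.
Qed.

Lemma corona_P3_b_colorable4 p : 1 < p ->
  b_colorable (svn_corona (path_graph 3) (path_graph p.+1)) 4.
Proof.
case: p => [|[|p]] // _.
apply: (@corona_b_colorable_cyc 1 p.+2 3 (nth 0 [:: 0; 1]) (nth 0 [:: 1; 2; 0])
  (nth [::] [:: [:: 2; 3]; [:: 2; 3]; [:: 2; 3]])).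
- by do 2?[case=> //].
- by do 3?[case=> //].
- by do 2?[case=> //].
case=> [|[|[|[|//]]]] _.
- by left; exists 0; split=> // j jk jc; apply: (@ev_sees_leq _ 2) => //; case: j jk jc; do 4?[case=> //].
- by left; exists 1; split=> // j jk jc; apply: (@ev_sees_leq _ 2) => //; case: j jk jc; do 4?[case=> //].
(* Each vertex of the middle copy sees both inserted vertices, coloured 0 and 1, so one neighbour in
   the copy is enough. *)
- by right; exists 1, 0; split=> //; do 4?[case=> //].
- by right; exists 1, 1; split=> //; do 4?[case=> //].
Qed.

Lemma corona_P3_b_colorable5 p : 3 < p ->
  b_colorable (svn_corona (path_graph 3) (path_graph p.+1)) 5.
Proof.
case: p => [|[|[|[|p]]]] // _.
apply: (@corona_b_colorable_cyc 1 p.+4 4 (nth 0 [:: 0; 1]) (nth 0 [:: 1; 2; 0])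
  (nth [::] [:: [:: 2; 3]; [:: 2; 3; 4]; [:: 2; 3]])).
- by do 2?[case=> //].
- by do 3?[case=> //].
- by do 2?[case=> //].
case=> [|[|[|[|[|//]]]]] _.
- by left; exists 0; split=> // j jk jc; apply: (@ev_sees_leq _ 2) => //; case: j jk jc; do 5?[case=> //].
- by left; exists 1; split=> // j jk jc; apply: (@ev_sees_leq _ 2) => //; case: j jk jc; do 5?[case=> //].
(* The word 2, 3, 4 needs three consecutive inner vertices as b-vertices, at positions 1 to 3; hence
   [3 < p]. *)
- by right; exists 1, 3; split=> //; do 5?[case=> //].
- by right; exists 1, 1; split=> //; do 5?[case=> //].
- by right; exists 1, 2; split=> //; do 5?[case=> //].
Qed.

Lemma corona_P45_b_colorable5 m p : m \in [:: 2; 3] -> 1 < p ->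
  b_colorable (svn_corona (path_graph m.+2) (path_graph p.+1)) 5.
Proof.
case: p => [|[|p]] // mE _.
(* One colouring serves both values of [m]. Colours 0, 1, 2 have inserted b-vertices; 3 and 4 have
   theirs at position 1 in the copies at 1 and 2. *)
apply: (@corona_b_colorable_cyc m p.+2 4 (nth 0 [:: 0; 1; 2; 0])
  (nth 0 [:: 1; 3; 3; 1; 1])
  (nth [::] [:: [:: 3; 4]; [:: 2; 3; 4]; [:: 0; 4; 3]; [:: 3; 4]; [:: 3; 4]]));
  move: mE; rewrite !inE => /orP[]/eqP ->.
1,2: by do 4?[case=> //].
1,2: by do 5?[case=> //].
1,2: by do 4?[case=> //].
all: case=> [|[|[|[|[|//]]]]] _.
1,6: by left; exists 0; split=> // j jk jc; apply: (@ev_sees_leq _ 2) => //; case: j jk jc; do 5?[case=> //].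
1,5: by left; exists 1; split=> // j jk jc; apply: (@ev_sees_leq _ 2) => //; case: j jk jc; do 5?[case=> //].
1,4: by left; exists 2; split=> // j jk jc; apply: (@ev_sees_leq _ 2) => //; case: j jk jc; do 5?[case=> //].
1,3: by right; exists 1, 1; split=> //; do 5?[case=> //].
1,2: by right; exists 2, 1; split=> //; do 5?[case=> //].
Qed.

(** * The general colouring by parity sets *)

(* For [k = 2 t + 3] these sets are forced: with [e_i] of colour [i], the sets
   at [u_i] and [u_{i+1}] must partition the colours other than [i]. *)
Definition wcol (k i : nat) : seq nat := [seq c <- iota 0 k | odd (c + i) == (i <= c)].

Lemma mem_wcol k i c : (c \in wcol k i) = (c < k) && (odd (c + i) == (i <= c)).
Proof. by rewrite mem_filter mem_iota add0n andbC. Qed.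

Lemma size_wcol k i : size (wcol k i) =
  if k <= i then (k + ~~ odd i)./2 else (k - odd i)./2.
Proof.
rewrite size_filter; elim: k => [|k IHk]; first by case: odd.
rewrite -addn1 iotaD count_cat IHk /= addn0 add0n oddD.
case: (leqP k i) => ki; case: (leqP (k + 1) i) => ki'; case: (leqP i k) => ki'';
  case: (boolP (odd i)) => oi; case: (boolP (odd k)) => ok /=; lia.
Qed.

Lemma corona_b_colorable_wcol m p k : 4 < k -> k <= m.+1 -> k <= 2 * p + 5 ->
  b_colorable (svn_corona (path_graph m.+2) (path_graph p.+1)) k.
Proof.
case: k => // k k4 km kp.
(* Past [k.+1] the sets stay constant: they avoid [k], the colour of all later inserted vertices. *)
pose W i := wcol k.+1 (minn i k.+1).
(* At least 2 for a proper periodic word; at most the [p.+1] vertices of the copy plus the vertex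
   [uv i]. *)
have sizeW i : 1 < size (W i) <= p.+2.
  rewrite /W size_wcol; have := geq_minr i k.+1; move: (minn _ _) => j jk.
  by case: (boolP (odd j)) => oj; case: ifP => /=; lia.
have memW i : {in W i, forall c, c <= k} by move=> c; rewrite mem_wcol => /andP[].
apply: (@corona_b_colorable_cyc m p k (minn^~ k) (fun i => last 0 (W i)) W).
- by move=> i _; rewrite geq_minr.
- move=> i _; have /andP[s2 _] := sizeW i; rewrite s2 filter_uniq ?iota_uniq //=.
  rewrite (memW i) /=; first by apply/allP/memW.
  by case: (W i) s2 => //= a s _; apply: mem_last.
- move=> i _.
  have aux d : d = i \/ d = i.+1 -> minn i k \notin last 0 (W d) :: W d.
    move=> di; have /andP[s2 _] := sizeW d.
    have : last 0 (W d) \in W d by case: (W d) s2 => //= a s _; apply: mem_last.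
    have : minn i k \notin W d by rewrite mem_wcol; case: di => ->; lia.
    by move=> iW lW; rewrite inE negb_or iW andbT; apply: contraNneq iW => ->.
  by rewrite !aux; auto.
move=> c ck; left; exists c; split; [lia | lia |] => j jk jc.
(* Passing from [c] to [c.+1] flips the parity condition but not the comparison with [j], as
   [j != c]; so [j] lies in exactly one of the two sets. *)
have [d dc jW] : exists2 d, d \in [:: c; c.+1] & j \in W d.
  case: (boolP (j \in W c)) => [|jN]; first by exists c; rewrite ?inE ?eqxx.
  exists c.+1; rewrite ?inE ?eqxx ?orbT //; move: jN; rewrite !mem_wcol; lia.
apply/hasP; exists d => //; have /andP[s2 sp] := sizeW d.
have [ip|ip] := leqP (index j (W d)) p.
  apply/orP; right; apply/hasP; exists (index j (W d)); first by rewrite mem_iota.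
  by apply/eqP; apply: cyc_index.
(* Only the last of [p.+2] elements can fall outside the copy, and it is the colour of [uv d]. *)
rewrite -nth_last; apply/orP; left; apply/eqP.
have -> : (size (W d)).-1 = index j (W d); last exact: nth_index.
have : index j (W d) < size (W d) by rewrite index_mem.
by move: (index _ _) (size _) ip sp => a b; lia.
Qed.

Theorem theorem6 (n t : nat) (hn : 2 < n) (ht : 2 < t) :
  b_chromatic (svn_corona (path_graph n) (path_graph t)) =
    if (n == 3) && (t \in [:: 3; 4]) then 4
    else if ((n == 3) && (5 <= t)) || (n \in [:: 4; 5]) then 5
    else if 6 <= n <= 2 * t + 3 then n - 1
    else 2 * t + 3.
Proof.
case: n hn => [|[|m]] // hn; case: t ht => [|p] // ht.
have ge k : b_colorable (svn_corona (path_graph m.+2) (path_graph p.+1)) k ->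
    k <= b_chromatic (svn_corona (path_graph m.+2) (path_graph p.+1)).
  exact: b_colorable_leq_b_chromatic.
have le b : (forall k, b_colorable (svn_corona (path_graph m.+2) (path_graph p.+1)) k ->
    5 < k -> k <= m.+1 -> k <= 2 * p + 5 -> k <= b) -> 4 < b ->
    b_chromatic (svn_corona (path_graph m.+2) (path_graph p.+1)) <= b.
  move=> leb b5; apply: b_chromatic_leq => k kP; have [/leq_trans->//|k5] := leqP k 5.
  by have [km kp] := corona_colors_leq k5 kP; apply: leb.
(* Here [m.+1] is [n - 1] and [2 * p + 5] is [2 * t + 3]. Since [b] is at least 5, only colourings
   with more than 5 colours matter, and these force [5 < m.+1]. *)
have eq_b b : 4 < b -> b_colorable (svn_corona (path_graph m.+2) (path_graph p.+1)) b ->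
    (5 < m.+1 -> minn m.+1 (2 * p + 5) <= b) ->
    b_chromatic (svn_corona (path_graph m.+2) (path_graph p.+1)) = b.
  move=> b5 bP leb; apply/eqP; rewrite eqn_leq ge // andbT.
  by apply: le => // k _ k5 km kp; apply: leq_trans (leb _); lia.
case: ifP => [/andP[/eqP[m1]]|c1].
  rewrite !inE => p34; apply/eqP; rewrite eqn_leq; apply/andP; split.
    by apply: b_chromatic_leq => k; apply: corona_P3_colors_leq; lia.
  by apply: ge; rewrite m1; apply: corona_P3_b_colorable4; lia.
case: ifP => [/orP[/andP[/eqP[m1] p4]|m23]|c2].
- by apply: eq_b => //; [rewrite m1; apply: corona_P3_b_colorable5 | lia].
- apply: eq_b => //; first by apply: corona_P45_b_colorable5.
  by move: m23; rewrite !inE; lia.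
have m3 : 3 < m by move: c1 c2; rewrite !inE; lia.
by case: ifP => c3; apply: eq_b; try apply: corona_b_colorable_wcol; lia.
Qed.
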